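(* Let $n\ge 1$, $r\ge 1$, and let $0=d_1\le d_2\le\cdots\le d_r$ be integers; put $N=n+d_r$. Let $k$ be a field, $E=\bigwedge(k^n)$, and let $F=\bigoplus_{i=1}^r Eg_i$ be the graded free $E$-module with $\deg g_i=d_i$. Then, as subsets of $\mathbb R^{N+1}$ (coordinates indexed by $0,1,\dots,N$), $$\operatorname{conv}\bigl\{H_{F/M} : M\subseteq F \text{ a proper monomial submodule}\bigr\}\;=\;\sum_{i=1}^r \operatorname{shift}^{d_i}\bigl(\operatorname{Koz}(n)\bigr)\;=\;\operatorname{Koz}(n;d_1,\dots,d_r),$$ where the sum is a Minkowski sum. Equivalently, $\operatorname{Koz}(n;d_1,\dots,d_r)$ is the convex hull of the set of $\mathrm{ff}$-vectors $\operatorname{ff}(\vec\Delta)$ (with respect to $(d_1,\dots,d_r)$) of all $r$-vectors $\vec\Delta=(\Delta_1,\dots,\Delta_r)$ of simplicial complexes on $[n]$.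
   Context: $[n]=\{1,\dots,n\}$. $E=\bigwedge(k^n)$ is the exterior algebra on generators $e_1,\dots,e_n$, graded with $\deg e_i=1$; for $\sigma=\{s_1<\cdots<s_j\}\subseteq[n]$, $e_\sigma=e_{s_1}\wedge\cdots\wedge e_{s_j}$. Monomials of $E$ are the $e_\sigma$; monomials of $F$ are the $e_\sigma g_i$, of degree $|\sigma|+d_i$. For a graded submodule $M\subseteq F$, $H_{F/M}(j)=\dim_k(F/M)_j$, viewed as the vector $(H_{F/M}(0),\dots,H_{F/M}(N))\in\mathbb R^{N+1}$. A monomial submodule of $F$ is a submodule generated by monomials of $F$; it has the form $M=I_1g_1\oplus\cdots\oplus I_rg_r$ with each $I_i\subseteq E$ a monomial ideal. It is proper if each $I_i$ has no minimal generator of degree $\le 1$, i.e. $(I_i)_{\le 1}=0$ for every $i$. A simplicial complex on $[n]$ is a family $\Delta$ of subsets of $[n]$, closed under taking subsets, containing $\emptyset$ and every singleton $\{i\}$, $i\in[n]$. $\mathcal S_n$ is the set of these. $f_j(\Delta)$ is the number of $\sigma\in\Delta$ with $|\sigma|=j$, with $f_j(\Delta)=0$ for $j<0$ or $j>n$. Put $$S_n=\{(f_0(\Delta),f_1(\Delta),\dots,f_n(\Delta)):\Delta\in\mathcal S_n\}\subseteq\mathbb Z^{n+1}$$ (always $f_0=1$, $f_1=n$). The Kozlov simplex is $\operatorname{Koz}(n)=\operatorname{conv}(S_n)\subseteq\mathbb R^{n+1}$. For $0\le d\le d_r$, $\operatorname{shift}^d:\mathbb R^{n+1}\to\mathbb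 R^{N+1}$ is the linear map that prepends $d$ zeros and pads with zeros on the right (with coordinates indexed from $0$, $e_j\mapsto e_{j+d}$). The Kozlov polytope is $\operatorname{Koz}(n;d_1,\dots,d_r)=\sum_{i=1}^r\operatorname{shift}^{d_i}(\operatorname{Koz}(n))$. An $r$-vector of simplicial complexes on $[n]$ is a tuple $\vec\Delta=(\Delta_1,\dots,\Delta_r)$ with $\Delta_i\in\mathcal S_n$ chosen independently; its $\mathrm{ff}$-vector is $\operatorname{ff}(\vec\Delta)_j=\sum_{i=1}^r f_{j-d_i}(\Delta_i)$, $j=0,\dots,N$. *)

(* Defs.v *)
From HB Require Import structures.
From mathcomp Require Import all_boot all_order all_algebra.

Set Implicit Arguments.
Unset Strict Implicit.
Unset Printing Implicit Defensive.

Import Order.TTheory GRing.Theory Num.Theory.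
Local Open Scope ring_scope.

(* An element of the exterior algebra on e_0, ..., e_(n-1) is the family of its
   coordinates in the basis of the monomials e_s, for s a subset of 'I_n. *)
Definition ext (k : fieldType) (n : nat) : Type := {ffun {set 'I_n} -> k}.

HB.instance Definition _ (k : fieldType) (n : nat) :=
  Vector.copy (ext k n) {ffun {set 'I_n} -> k^o}.

Section ExteriorAlgebra.
Variables (k : fieldType) (n : nat).
Implicit Types (a b c : ext k n) (s t u : {set 'I_n}).

Definition emon s : ext k n := [ffun t => (t == s)%:R].

Definition inversions s t : nat := (\sum_(i in s) \sum_(j in t) (j < i))%N.

(* e_s /\ e_t: sorting the concatenation of the increasing words s and t takes
   inversions s t transpositions. *)
Definition wedge s t : ext k n :=
  if [disjoint s & t] then (-1) ^+ inversions s t *: emon (s :|: t) else 0.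

Definition ext_mul a b : ext k n := \sum_s \sum_t (a s * b t) *: wedge s t.

Lemma ext_basis a : a = \sum_s a s *: emon s.
Proof.
apply/ffunP => t; rewrite sum_ffunE (bigD1 t) //= big1 => [|s /negPf ts].
  by rewrite !ffunE eqxx addr0 /GRing.scale /= mulr1.
by rewrite !ffunE eq_sym ts /GRing.scale /= mulr0.
Qed.

Let ext_mul_linear_l b : linear (ext_mul^~ b).
Proof.
move=> x a c; rewrite /ext_mul scaler_sumr -big_split; apply: eq_bigr => s _ /=.
rewrite scaler_sumr -big_split; apply: eq_bigr => t _ /=.
by rewrite scalerA -scalerDl !ffunE mulrDl /GRing.scale /= mulrA.
Qed.

Let ext_mul_linear_r a : linear (ext_mul a).
Proof.
move=> x b c; rewrite /ext_mul scaler_sumr -big_split; apply: eq_bigr => s _ /=.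
rewrite scaler_sumr -big_split; apply: eq_bigr => t _ /=.
by rewrite scalerA -scalerDl !ffunE mulrDr /GRing.scale /= mulrCA.
Qed.

Let xmul0l b : ext_mul 0 b = 0.
Proof.
by have := ext_mul_linear_l b (-1) 0 0; rewrite scaler0 addr0 scaleN1r addNr.
Qed.

Let xmul0r a : ext_mul a 0 = 0.
Proof.
by have := ext_mul_linear_r a (-1) 0 0; rewrite scaler0 addr0 scaleN1r addNr.
Qed.

Let xmulZl x a b : ext_mul (x *: a) b = x *: ext_mul a b.
Proof. by rewrite -[x *: a]addr0 ext_mul_linear_l xmul0l addr0. Qed.

Let xmulZr x a b : ext_mul a (x *: b) = x *: ext_mul a b.
Proof. by rewrite -[x *: b]addr0 ext_mul_linear_r xmul0r addr0. Qed.

Let xmulDl : left_distributive ext_mul +%R.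
Proof. by move=> a b c; rewrite -[a]scale1r ext_mul_linear_l !scale1r. Qed.

Let xmulDr : right_distributive ext_mul +%R.
Proof. by move=> a b c; rewrite -[b]scale1r ext_mul_linear_r !scale1r. Qed.

Let ext_ind (P : ext k n -> Prop) : P 0 -> (forall s, P (emon s)) ->
  (forall x a b, P a -> P b -> P (x *: a + b)) -> forall a, P a.
Proof.
move=> P0 Pe Plin a; rewrite [a]ext_basis.
by elim/big_rec: _ => // s b _ Pb; exact: Plin.
Qed.

Let ext_mul_emon s t : ext_mul (emon s) (emon t) = wedge s t.
Proof.
rewrite /ext_mul (bigD1 s) //= [X in _ + X]big1 => [|s' /negPf ss']; last first.
  by apply: big1 => t' _; rewrite ffunE ss' mul0r scale0r.
rewrite (bigD1 t) //= [X in _ + X + _]big1 => [|t' /negPf tt']; last first.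
  by rewrite [emon t t']ffunE tt' mulr0 scale0r.
by rewrite !ffunE !eqxx mul1r scale1r !addr0.
Qed.

Let inversionsUl s t u : [disjoint s & t] ->
  inversions (s :|: t) u = (inversions s u + inversions t u)%N.
Proof.
move=> st; rewrite /inversions -bigU //=.
by apply: eq_bigl => i; rewrite !inE.
Qed.

Let inversionsUr s t u : [disjoint t & u] ->
  inversions s (t :|: u) = (inversions s t + inversions s u)%N.
Proof.
move=> tu; rewrite /inversions -big_split /=.
apply: eq_bigr => i _; rewrite -bigU //=.
by apply: eq_bigl => j; rewrite !inE.
Qed.

Let wedgeA s t u : ext_mul (emon s) (wedge t u) = ext_mul (wedge s t) (emon u).
Proof.
rewrite /wedge; case: (boolP [disjoint t & u]) => tu; last first.
  case: ifP => _; rewrite ?xmul0l xmul0r // xmulZl ext_mul_emon /wedge ifN.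
    by rewrite scaler0.
  by apply: contra tu; apply: disjointWl; exact: subsetUr.
case: (boolP [disjoint s & t]) => st; last first.
  rewrite xmul0l xmulZr ext_mul_emon /wedge ifN ?scaler0 //.
  by apply: contra st; apply: disjointWr; exact: subsetUl.
rewrite xmulZl xmulZr !ext_mul_emon /wedge -!setI_eq0 setIUr setIUl !setU_eq0.
rewrite !setI_eq0 tu st andbT /=; case: ifP => su; last by rewrite !scaler0.
rewrite !scalerA -!exprD setUA inversionsUl // inversionsUr //.
by congr (_ ^+ _ *: _); rewrite addnC addnA.
Qed.

Let xmulA : associative ext_mul.
Proof.
move=> a b c; elim/ext_ind: a => [|s|x a a' IHa IHa']; first by rewrite !xmul0l.
  elim/ext_ind: b => [|t|x b b' IHb IHb']; first by rewrite !(xmul0l, xmul0r).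
    elim/ext_ind: c => [|u|x c c' IHc IHc']; first by rewrite !xmul0r.
      by rewrite !ext_mul_emon wedgeA.
    by rewrite !ext_mul_linear_r IHc IHc'.
  by rewrite ext_mul_linear_l !ext_mul_linear_r ext_mul_linear_l IHb IHb'.
by rewrite !ext_mul_linear_l IHa IHa'.
Qed.

Let inversions0s t : inversions set0 t = 0%N.
Proof. by rewrite /inversions big_set0. Qed.

Let inversionss0 s : inversions s set0 = 0%N.
Proof. by rewrite /inversions big1 // => i _; rewrite big_set0. Qed.

Let xmul1l : left_id (emon set0) ext_mul.
Proof.
move=> a; elim/ext_ind: a => [|s|x a b IHa IHb]; first by rewrite xmul0r.
  rewrite ext_mul_emon /wedge -setI_eq0 set0I eqxx inversions0s.
  by rewrite scale1r set0U.
by rewrite ext_mul_linear_r IHa IHb.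
Qed.

Let xmul1r : right_id (emon set0) ext_mul.
Proof.
move=> a; elim/ext_ind: a => [|s|x a b IHa IHb]; first by rewrite xmul0l.
  rewrite ext_mul_emon /wedge -setI_eq0 setI0 eqxx inversionss0.
  by rewrite scale1r setU0.
by rewrite ext_mul_linear_l IHa IHb.
Qed.

Let one_neq0 : emon set0 != 0.
Proof.
by apply/eqP => /ffunP/(_ set0)/eqP; rewrite !ffunE eqxx oner_eq0.
Qed.

HB.instance Definition _ := GRing.Zmodule_isNzRing.Build (ext k n)
  xmulA xmul1l xmul1r xmulDl xmulDr one_neq0.

Let scaleAl (x : k) a b : x *: (a * b) = (x *: a) * b.
Proof. by rewrite [RHS]xmulZl. Qed.

HB.instance Definition _ := GRing.Lmodule_isLalgebra.Build k (ext k n) scaleAl.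

Let scaleAr (x : k) a b : x *: (a * b) = a * (x *: b).
Proof. by rewrite [RHS]xmulZr. Qed.

HB.instance Definition _ := GRing.Lalgebra_isAlgebra.Build k (ext k n) scaleAr.

Lemma emonM s t : emon s * emon t = wedge s t.
Proof. exact: ext_mul_emon. Qed.

Lemma emon0 : emon set0 = 1.
Proof. by []. Qed.

Lemma emon1_sqr i : emon [set i] * emon [set i] = 0.
Proof. by rewrite emonM /wedge -setI_eq0 setIid -cards_eq0 cards1. Qed.

Lemma emon1_anticomm i j :
  emon [set i] * emon [set j] = - (emon [set j] * emon [set i]).
Proof.
have [->|ij] := eqVneq i j; first by rewrite emon1_sqr oppr0.
rewrite !emonM /wedge !disjoints1 !in_set1 ij eq_sym ij setUC.
rewrite /inversions !big_set1 -scaleNr; congr (_ *: _).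
case: ltngtP ij => [_|_|/val_inj ->]; last by rewrite eqxx.
  by rewrite expr0 expr1.
by rewrite expr0 expr1 opprK.
Qed.

Lemma emon_prod s : emon s = \prod_(i <- enum s) emon [set i].
Proof.
have: sorted ltn (map val (enum s)).
  rewrite -[enum _](eq_filter (mem_enum _)) -(eq_filter (mem_map val_inj _)).
  rewrite -filter_map (sorted_filter ltn_trans) // unlock val_ord_enum.
  exact: iota_ltn_sorted.
rewrite -[s in LHS]set_enum; elim: (enum s) => [|i l IHl] /= il.
  by rewrite big_nil -emon0; congr emon; apply/setP => j; rewrite !inE.
have lt_il j : j \in l -> (i < j)%N.
  move: il; rewrite (path_sortedE ltn_trans) all_map.
  by move=> /andP[/allP + _]; apply.
rewrite big_cons -IHl ?(path_sorted il) // emonM /wedge disjoints1 inE.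
rewrite ifT; last first.
  by apply/negP => /lt_il; rewrite ltnn.
rewrite set_cons /inversions big_set1 big1 ?expr0 ?scale1r // => j.
by rewrite inE => /lt_il; case: ltngtP.
Qed.

End ExteriorAlgebra.

Section FreeModule.
Variables (k : fieldType) (n r : nat) (d : 'I_r -> nat).

Definition free_mod := {ffun 'I_r -> ext k n}.

Implicit Types (a : ext k n) (v : free_mod) (M : {vspace free_mod}).

Definition ext_act a v : free_mod := [ffun i => a * v i].

Definition free_gen (i : 'I_r) : free_mod := [ffun j => (j == i)%:R].

Lemma free_genE v : v = \sum_i ext_act (v i) (free_gen i).
Proof.
apply/ffunP => j; rewrite sum_ffunE (bigD1 j) //= big1 => [|i /negPf ij].
  by rewrite !ffunE eqxx mulr1 addr0.
by rewrite !ffunE eq_sym ij mulr0.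
Qed.

Definition fmon (p : {set 'I_n} * 'I_r) : free_mod :=
  ext_act (emon k p.1) (free_gen p.2).

Definition ext_deg (j : nat) : {vspace ext k n} :=
  (\sum_(s : {set 'I_n} | (#|s| == j)%N) <[emon k s]>)%VS.

Definition free_deg (j : nat) : {vspace free_mod} :=
  (\sum_(p : {set 'I_n} * 'I_r | (#|p.1| + d p.2 == j)%N) <[fmon p]>)%VS.

(* Every submodule over the exterior algebra is a k-subspace, hence the use of
   the type of subspaces. *)
Definition submodule M := forall a v, v \in M -> ext_act a v \in M.

Definition generated_by (G : {set {set 'I_n} * 'I_r}) M :=
  [/\ submodule M,
      {in G, forall p, fmon p \in M} &
      forall M', submodule M' -> {in G, forall p, fmon p \in M'} ->
        (M <= M')%VS].

Definition monomial_submodule M := exists G, generated_by G M.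

(* Not M != F: the component ideals {a | ext_act a (free_gen i) \in M} must be
   zero in degrees 0 and 1. *)
Definition proper_submodule M :=
  forall i a, a \in (ext_deg 0 + ext_deg 1)%VS ->
    ext_act a (free_gen i) \in M -> a = 0.

(* The dimension of (F / M)_j = F_j / (M :&: F_j); hilbert_quot compares it with
   the image of F_j in a quotient of F by M. *)
Definition hilbert_fun M (j : nat) : nat :=
  (\dim (free_deg j) - \dim (free_deg j :&: M))%N.

Lemma hilbert_quot M j (Q : vectType k) (pi : 'Hom(free_mod, Q)) :
  lker pi = M -> hilbert_fun M j = \dim (pi @: free_deg j).
Proof.
by move=> <-; rewrite /hilbert_fun -(limg_ker_dim pi (free_deg j)) addKn.
Qed.

End FreeModule.

Section FaceNumbers.
Variable n : nat.

Definition simplicial_complex (D : {set {set 'I_n}}) :=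
  [/\ set0 \in D,
      forall i : 'I_n, [set i] \in D &
      forall s t : {set 'I_n}, t \subset s -> s \in D -> t \in D].

(* Faces are counted by cardinality, so that fnum D 1 is the number of
   vertices. The index is an integer: fnum D j = 0 for j < 0. *)
Definition fnum (D : {set {set 'I_n}}) (j : int) : nat :=
  #|[set s in D | #|s|%:Z == j]|.

End FaceNumbers.

From mathcomp Require Import classical_sets reals convex.
Local Open Scope classical_set_scope.

Definition conv_hull (R : realType) (V : lmodType R) (A : set V) : set V :=
  smallest (@convex_set R V) A.

Definition minkowski_sum (V : nmodType) (I : finType) (A : I -> set V) :
    set V :=
  [set \sum_i x i | x in [set x : I -> V | forall i, A i (x i)]].

Section Kozlov.
Variables (R : realType) (n : nat).

Definition fvec (D : {set {set 'I_n}}) : 'rV[R]_n.+1 :=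
  \row_(j < n.+1) (fnum D j)%:R.

Definition kozlov_simplex : set 'rV[R]_n.+1 :=
  conv_hull [set fvec D | D in @simplicial_complex n].

(* Row vectors act on the left: the basis vector e_i is sent to e_(i + c). *)
Definition koz_shift (N c : nat) (v : 'rV[R]_n.+1) : 'rV[R]_N.+1 :=
  v *m \matrix_(i < n.+1, j < N.+1) (j == (i + c)%N :> nat)%:R.

Variables (r : nat) (d : 'I_r.+1 -> nat).

Let N := (n + d ord_max)%N.

Definition kozlov_polytope : set 'rV[R]_N.+1 :=
  minkowski_sum (fun i => koz_shift N (d i) @` kozlov_simplex).

Definition ffvec (D : 'I_r.+1 -> {set {set 'I_n}}) : 'rV[R]_N.+1 :=
  \row_(j < N.+1) \sum_i (fnum (D i) (j%:Z - (d i)%:Z))%:R.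

Definition hilbert_vec (k : fieldType) (M : {vspace free_mod k n r.+1}) :
    'rV[R]_N.+1 :=
  \row_(j < N.+1) (hilbert_fun d M j)%:R.

End Kozlov.

Arguments kozlov_simplex R n : clear implicits.
Arguments kozlov_polytope R n [r] d.

(* Main.v *)
(* A monomial submodule M is spanned by the monomials e_s g_i it contains, so
   H_(F/M) counts the monomials outside M. These form an r-tuple of families
   D_i = {s | e_s g_i not in M} closed under subsets, and M is proper exactly
   when each D_i contains the empty set and the singletons; hence the vectors
   H_(F/M) are the ff-vectors, i.e. the sums of shifted f-vectors. Taking convex
   hulls commutes with linear maps and with Minkowski sums. *)
Require Import Defs.
From mathcomp Require Import all_boot all_order all_algebra.

Set Implicit Arguments.
Unset Strict Implicit.
Unset Printing Implicit Defensive.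

Import GRing.Theory.

(** * Submodules spanned by monomials, as coordinate subspaces *)

Section MonomialSpan.
Local Open Scope ring_scope.
Variables (k : fieldType) (n r : nat).
Local Notation mon := ({set 'I_n} * 'I_r)%type.
Implicit Types (p q : mon) (P Q : {set mon}) (v : free_mod k n r)
  (s t u : {set 'I_n}) (i j : 'I_r).

Definition mspan P : {vspace free_mod k n r} :=
  (\sum_(p in P) <[fmon k p]>)%VS.

Lemma fmonE p q : fmon k p q.2 q.1 = (q == p)%:R.
Proof.
case: p q => [s i] [t j]; rewrite !ffunE /= xpair_eqE andbC.
by case: eqVneq => _; rewrite ?mulr1 ?mulr0 ffunE.
Qed.

Lemma free_mod_sum v : v = \sum_p v p.2 p.1 *: fmon k p.
Proof.
apply/ffunP => i; apply/ffunP => s.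
rewrite !sum_ffunE (bigD1 (s, i)) //= [X in _ + X]big1 ?addr0.
  rewrite [in RHS]ffunE [in RHS]ffunE.
  have /= -> := fmonE (s, i) (s, i).
  by rewrite eqxx /GRing.scale /= mulr1.
move=> p pi; rewrite ffunE [in LHS]ffunE; have /= -> := fmonE p (s, i).
by rewrite eq_sym (negPf pi) /GRing.scale /= mulr0.
Qed.

Lemma mspanP P v :
  reflect (forall p, p \notin P -> v p.2 p.1 = 0) (v \in mspan P).
Proof.
apply: (iffP idP) => [/memv_sumP[u uP ->] p pP|v0].
  rewrite !sum_ffunE big1 // => q qP.
  have /vlineP[c ->] := uP q qP.
  rewrite ffunE ffunE fmonE; case: eqVneq pP => [->|_ _]; first by rewrite qP.
  by rewrite /GRing.scale /= mulr0.
rewrite [v]free_mod_sum; apply: memv_suml => p _.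
have [pP|/v0 ->] := boolP (p \in P); last by rewrite scale0r mem0v.
by apply: memvZ; apply: (subvP (sumv_sup p pP (subvv _))); exact: memv_line.
Qed.

Lemma fmon_mspan P p : (fmon k p \in mspan P) = (p \in P).
Proof.
apply/mspanP/idP => [|pP q qP]; last first.
  by rewrite fmonE; case: eqVneq qP => // ->; rewrite pP.
by apply: contraPT => pP /(_ p pP)/eqP; rewrite fmonE eqxx oner_eq0.
Qed.

Lemma mspan_sub P (M : {vspace free_mod k n r}) :
  {in P, forall p, fmon k p \in M} -> (mspan P <= M)%VS.
Proof. by move=> PM; apply/subv_sumP => p /PM; rewrite -memvE. Qed.

Lemma mspanI P Q : (mspan P :&: mspan Q)%VS = mspan (P :&: Q).
Proof.
apply/vspaceP => v; rewrite memv_cap; apply/andP/mspanP.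
  move=> [/mspanP vP /mspanP vQ] p; rewrite inE negb_and => /orP[/vP|/vQ] //.
by move=> v0; split; apply/mspanP => p pP; apply: v0;
  rewrite inE (negPf pP) ?andbF.
Qed.

Lemma dim_mspan P : \dim (mspan P) = #|P|.
Proof.
have /directvP/= -> : directv (mspan P).
  apply/directv_sum_independent => u uP u0 p pP.
  have /vlineP[c uE] := uP p pP; rewrite uE.
  suff -> : c = 0 by rewrite scale0r.
  (* In the vanishing sum, coordinate [p] sees only the term at [p], which forces [c = 0]. *)
  move/ffunP/(_ p.2)/ffunP/(_ p.1) : u0.
  rewrite !sum_ffunE (bigD1 p) //= big1 => [|q /andP[qP qp]].
    rewrite uE !ffunE; have := fmonE p p.
    by rewrite !ffunE => ->; rewrite eqxx addr0 /GRing.scale /= mulr1.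
  have /vlineP[c' ->] := uP q qP; rewrite ffunE ffunE fmonE.
  by rewrite eq_sym (negPf qp) /GRing.scale /= mulr0.
rewrite -sum1_card; apply: eq_bigr => p _; rewrite dim_vline.
have [p0|//] := eqVneq; move/ffunP/(_ p.2)/ffunP/(_ p.1)/eqP : p0.
by rewrite fmonE !ffunE eqxx oner_eq0.
Qed.

(** The monomials divisible by one from [P]: divisibility keeps the generator and enlarges the
    subset. *)
Definition upward P :=
  [set p : mon | [exists q in P, (q.2 == p.2) && (q.1 \subset p.1)]].

Lemma upward_id P :
  (forall s t i, s \subset t -> (s, i) \in P -> (t, i) \in P) -> upward P = P.
Proof.
move=> Pup; apply/setP => -[t i]; rewrite inE; apply/exists_inP/idP.
  by move=> [[s j] sP /= /andP[/eqP <- st]]; exact: Pup sP.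
by move=> tP; exists (t, i) => //=; rewrite eqxx subxx.
Qed.

Lemma upward_closed P s t i :
  s \subset t -> (s, i) \in upward P -> (t, i) \in upward P.
Proof.
move=> st; rewrite !inE => /exists_inP[[u j] uP /= /andP[ji us]].
by apply/exists_inP; exists (u, j) => //=; rewrite ji (subset_trans us).
Qed.

(** Coordinate [s] of a product collects terms [a u * v t] with [s = u :|: t]. If [s] lies outside
    the upward set, so does its subset [t], and that coordinate of [v] is zero. *)
Lemma mspan_submodule P : submodule (mspan (upward P)).
Proof.
move=> a v /mspanP vP; apply/mspanP => -[s i] sP /=; rewrite ffunE.
rewrite [a * _]/(ext_mul a (v i)) /ext_mul sum_ffunE big1 // => u _.
rewrite sum_ffunE big1 // => t _; rewrite ffunE /wedge.
case: ifP => _; last by rewrite ffunE scaler0.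
rewrite ffunE ffunE; case: eqVneq => [su|_]; last by rewrite !scaler0.
have /= -> := vP (t, i); first by rewrite mulr0 scale0r.
by apply: contra sP; apply: upward_closed; rewrite su subsetUr.
Qed.

(** Multiplying by the monomial of [t :\: s] yields the monomial of [t] up to a sign, and the sign
    squares to 1. *)
Lemma submodule_fmon (M : {vspace free_mod k n r}) s t i :
  submodule M -> s \subset t -> fmon k (s, i) \in M -> fmon k (t, i) \in M.
Proof.
move=> subM st /(subM (emon k (t :\: s))).
have -> : ext_act (emon k (t :\: s)) (fmon k (s, i)) =
    (-1) ^+ inversions (t :\: s) s *: fmon k (t, i).
  apply/ffunP => j; rewrite !ffunE /= mulrA emonM /wedge.
  have -> : [disjoint t :\: s & s].
    rewrite -setI_eq0; apply/eqP/setP => x; rewrite !inE.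
    by case: (x \in s); rewrite ?andbF.
  have -> : t :\: s :|: s = t by rewrite setUC -{1}(setIidPr st) setID.
  by rewrite scalerAl.
move=> /(memvZ ((-1) ^+ inversions (t :\: s) s)).
by rewrite scalerA -expr2 sqrr_sign scale1r.
Qed.

Lemma mspan_upward_generated P : generated_by P (mspan (upward P)).
Proof.
split; first exact: mspan_submodule.
  move=> p pP; rewrite fmon_mspan inE.
  by apply/exists_inP; exists p; rewrite // eqxx subxx.
move=> M subM PM; apply: mspan_sub => -[t i]; rewrite inE.
move=> /exists_inP[[s j] /PM sM /= /andP[/eqP ji st]].
by apply: submodule_fmon st _ => //; rewrite -ji.
Qed.

(** Both sides are least among the submodules containing the monomials of [P], so each contains the
    other. *)
Lemma generated_byE P M : generated_by P M -> M = mspan (upward P).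
Proof.
move=> [subM PM minM]; have [subU PU minU] := mspan_upward_generated P.
apply/eqP; rewrite eqEsubv.
by apply/andP; split; [exact: minM|exact: minU].
Qed.

Lemma ext_deg_eq0 (a : ext k n) (j : nat) s :
  a \in ext_deg k n j -> #|s| != j -> a s = 0.
Proof.
move=> /memv_sumP[u uj ->] sj; rewrite sum_ffunE big1 // => t tj.
have /vlineP[c ->] := uj t tj; rewrite ffunE ffunE.
by case: (eqVneq s t) sj => [->|_ _]; rewrite ?tj ?scaler0.
Qed.

Lemma emon_ext_deg s : emon k s \in ext_deg k n #|s|.
Proof. by apply: (subvP (sumv_sup s _ (subvv _))); rewrite ?memv_line. Qed.

Lemma proper_mspan P : proper_submodule (mspan P) <->
  forall s i, (#|s| <= 1)%N -> (s, i) \notin P.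
Proof.
split=> [properP s i s1|P1 i a /memv_addP[b b0 [c c1 ->]] /mspanP aP].
  (* Otherwise [emon k s] is an element of degree at most 1 in the [i]-th component ideal, which
     properness forces to be zero. *)
  apply/negP => sP; have /ffunP/(_ s)/eqP : emon k s = 0.
    apply: (properP i); last first.
      by rewrite (_ : ext_act _ _ = fmon k (s, i)) ?fmon_mspan.
    case: #|s| s1 (emon_ext_deg s) => [|[|]] // _; apply/subvP.
      exact: addvSl.
    exact: addvSr.
  by rewrite !ffunE eqxx oner_eq0.
apply/ffunP => s; rewrite [RHS]ffunE.
(* Coordinates at small sets vanish by membership in [mspan P], those at larger sets because the
   element has degree at most 1. *)
have [s1|s1] := leqP #|s| 1.
  have := aP (s, i) (P1 s i s1).
  by rewrite !ffunE /= eqxx mulr1 ffunE.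
by rewrite ffunE (ext_deg_eq0 b0) ?(ext_deg_eq0 c1) ?addr0 // gtn_eqF // ltnW.
Qed.

End MonomialSpan.

(** * Hilbert functions as counts of monomials *)

Section Hilbert.
Local Open Scope ring_scope.
Variables (k : fieldType) (n r : nat) (d : 'I_r -> nat).

(** Moving the shift to the other side leaves an equation in naturals; for [j < c] both counts are
    0. *)
Lemma fnumE (D : {set {set 'I_n}}) (j c : nat) :
  fnum D (j%:Z - c%:Z) = #|[set s in D | #|s| + c == j]%N|.
Proof.
by apply: eq_card => s; rewrite !inE [_ == _ - _]eq_sym subr_eq eq_sym -PoszD.
Qed.

(** The degree-[j] part is itself a monomial span, so the difference of dimensions counts the
    degree-[j] monomials outside [P], sorted here by generator. *)
Lemma hilbert_fun_mspan (P : {set {set 'I_n} * 'I_r}) (j : nat) :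
  hilbert_fun d (mspan k P) j =
  (\sum_i fnum [set s : {set 'I_n} | (s, i) \notin P] (j%:Z - (d i)%:Z))%N.
Proof.
pose Q := [set p : {set 'I_n} * 'I_r | #|p.1| + d p.2 == j]%N.
have free_degE : free_deg k n d j = mspan k Q.
  by apply: eq_bigl => p; rewrite inE.
rewrite /hilbert_fun free_degE mspanI !dim_mspan -cardsDS ?subsetIl //
   setDIr setDv set0U.
under eq_bigr do rewrite fnumE -sum1_card big_mkcond.
rewrite exchange_big pair_big -big_mkcond -sum1_card /=.
by apply: eq_bigl => -[s i]; rewrite !inE.
Qed.

End Hilbert.

From mathcomp Require Import boolp classical_sets reals convex.
From mathcomp Require Import interval_inference.

Local Open Scope classical_set_scope.

(** * Convex hulls under linear maps and Minkowski sums *)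

Section ConvexHull.
Local Open Scope ring_scope.
Local Open Scope convex_scope.
Variable R : realType.
Implicit Types V W : lmodType R.

Lemma convex_setE V (A : set V) : @convex_set R V A <->
  forall (t : {i01 R}) x y, A x -> A y ->
    A ((x : convex_lmodType V) <| t |> y).
Proof.
split=> [cA t x y Ax Ay|cA x y t xA yA].
  by have := cA x y t (mem_set Ax) (mem_set Ay); rewrite inE.
by rewrite inE; apply: cA; rewrite -in_setE.
Qed.

Lemma conv_hull_convex V (A : set V) : @convex_set R V (conv_hull A).
Proof.
apply/convex_setE => t x y Ax Ay C [cC AC].
by move/convex_setE : (cC); apply; [exact: (Ax C)|exact: (Ay C)].
Qed.

Lemma conv_hull_conv V (A : set V) (t : {i01 R}) x y :
  conv_hull A x -> conv_hull A y ->
  conv_hull A ((x : convex_lmodType V) <| t |> y).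
Proof. by move: t x y; apply/convex_setE/conv_hull_convex. Qed.

(** Preimages and images of convex sets under [f] are convex; minimality of the hull gives one
    inclusion from each. *)
Lemma conv_hull_affine V W (f : V -> W) (A : set V) :
  (forall (t : {i01 R}) (x y : V), f ((x : convex_lmodType V) <| t |> y) =
     (f x : convex_lmodType W) <| t |> f y) ->
  f @` conv_hull A = conv_hull (f @` A).
Proof.
move=> fconv; apply/seteqP; split.
  suff AfA : conv_hull A `<=` f @^-1` conv_hull (f @` A).
    by move=> _ [x Ax <-]; exact: AfA.
  apply: smallest_sub.
    apply/convex_setE => t y z /= fy fz; rewrite fconv.
    exact: conv_hull_conv.
  by move=> y Ay; apply: sub_gen_smallest; exists y.
apply: smallest_sub; last first.
  by move=> _ [x Ax <-]; exists x => //; exact: sub_gen_smallest.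
apply/convex_setE => t _ _ [x Ax <-] [y Ay <-].
exists ((x : convex_lmodType V) <| t |> y); last exact: fconv.
exact: conv_hull_conv.
Qed.

Lemma conv_hull_linear V W (f : {linear V -> W}) (A : set V) :
  f @` conv_hull A = conv_hull (f @` A).
Proof.
apply: conv_hull_affine => t x y.
by rewrite /conv /= linearD !linearZ.
Qed.

Lemma conv_hull_minkowski V (I : finType) (A : I -> set V) :
  minkowski_sum (fun i => conv_hull (A i)) = conv_hull (minkowski_sum A).
Proof.
apply/seteqP; split; last first.
  apply: smallest_sub; last first.
    by move=> _ [x Ax <-]; exists x => // i; exact: sub_gen_smallest (Ax i).
  apply/convex_setE => t _ _ [x Ax <-] [y Ay <-].
  exists (fun i => (x i : convex_lmodType V) <| t |> y i).
    by move=> i; exact: conv_hull_conv (Ax i) (Ay i).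
  by rewrite /conv /= big_split -!scaler_sumr.
(* The summands are moved from [A i] to its hull one index at a time, the
   summands of index outside [l] being still in [A i]. *)
suff hull (l : seq I) (x : I -> V) : (forall i, conv_hull (A i) (x i)) ->
    (forall i, i \notin l -> A i (x i)) ->
    conv_hull (minkowski_sum A) (\sum_i x i).
  move=> _ [x Ax <-]; apply: (hull (enum I) x Ax) => i.
  by rewrite mem_enum.
elim: l x => [|i l IHl] x Ax xl.
  by apply: sub_gen_smallest; exists x => // i; exact: xl.
pose c := \sum_(j | j != i) x j.
(* With the other summands frozen in [c], the admissible [y] form a convex set, so it is enough that
   it contains [A i]. *)
suff : conv_hull (A i) `<=` [set y | conv_hull (minkowski_sum A) (y + c)].
  by move=> /(_ _ (Ax i)); rewrite (bigD1 i).
apply: smallest_sub.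
  apply/convex_setE => t y z /= hy hz.
  have := conv_hull_conv t hy hz; congr (conv_hull _ _).
  by rewrite /conv /= !scalerDr addrACA -scalerDl subrKC scale1r.
move=> y Aiy /=.
have -> : y + c = \sum_j (if j == i then y else x j).
  rewrite (bigD1 i) //= eqxx; congr (_ + _).
  by apply: eq_bigr => j /negPf ->.
apply: IHl => j; case: eqVneq => [->|ji] //; first exact: sub_gen_smallest.
by move=> jl; apply: xl; rewrite inE negb_or ji.
Qed.

End ConvexHull.

(** * Hilbert vectors, ff-vectors and shifted f-vectors *)

Section FaceVectors.
Local Open Scope ring_scope.
Variables (R : realType) (n r : nat) (d : 'I_r.+1 -> nat).

Lemma hilbert_vec_mspan (k : fieldType) (P : {set {set 'I_n} * 'I_r.+1}) :
  hilbert_vec R d (mspan k P) =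
  ffvec R d (fun i => [set s : {set 'I_n} | (s, i) \notin P]%SET).
Proof. by apply/rowP => j; rewrite !mxE hilbert_fun_mspan natr_sum. Qed.

Lemma koz_shift_fvec (N c : nat) (D : {set {set 'I_n}}) :
  koz_shift N c (fvec R D) = \row_(j < N.+1) (fnum D (j%:Z - c%:Z))%:R.
Proof.
apply/rowP => j; rewrite !mxE fnumE -sum1_card natr_sum [RHS]big_mkcond /=.
under eq_bigr => i _ do
  rewrite !mxE -[i%:Z]subr0 fnumE -sum1_card natr_sum big_mkcond mulr_suml.
rewrite exchange_big; apply: eq_bigr => s _ /=.
(* After exchanging the sums, a face [s] contributes only at the index [#|s|], which is in range
   since [#|s| <= n]. *)
have s_n : (#|s| < n.+1)%N by rewrite ltnS -[n in (_ <= n)%N]card_ord max_card.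
rewrite (bigD1 (Ordinal s_n)) //= big1 => [|i /eqP si].
  rewrite !inE addn0 eqxx andbT addr0 eq_sym.
  by case: (s \in D); case: eqP; rewrite ?mul0r ?mulr1 ?mulr0.
rewrite !inE addn0; case: eqP => [s_i|_]; last by rewrite andbF mul0r.
by case: si; apply: val_inj.
Qed.

Lemma ffvec_minkowski :
  minkowski_sum (fun i => koz_shift (n + d ord_max) (d i) @`
    [set fvec R D | D in @simplicial_complex n]) =
  [set ffvec R d D | D in [set D : 'I_r.+1 -> {set {set 'I_n}} |
    forall i, simplicial_complex (D i)]].
Proof.
have ffvecE D :
    ffvec R d D = \sum_i koz_shift (n + d ord_max) (d i) (fvec R (D i)).
  apply/rowP => j; rewrite mxE summxE; apply: eq_bigr => i _.
  by rewrite koz_shift_fvec mxE.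
apply/seteqP; split => [_ [x xP <-]|_ [D DP <-]].
  have faces i : exists D : {set {set 'I_n}}, simplicial_complex D /\
      koz_shift (n + d ord_max) (d i) (fvec R D) = x i.
    by have [_ [D DS <-] <-] := xP i; exists D.
  have [D DP] := choice faces.
  exists D => [i|]; first by case: (DP i).
  by rewrite ffvecE; apply: eq_bigr => i _; case: (DP i).
exists (fun i => koz_shift (n + d ord_max) (d i) (fvec R (D i))).
  by move=> i; exists (fvec R (D i)) => //; exists (D i) => //; exact: (DP i).
by rewrite ffvecE.
Qed.

Lemma hilbert_vec_ffvec (k : fieldType) :
  [set hilbert_vec R d M | M in [set M : {vspace free_mod k n r.+1} |
    monomial_submodule M /\ proper_submodule M]] =
  [set ffvec R d D | D in [set D : 'I_r.+1 -> {set {set 'I_n}} |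
    forall i, simplicial_complex (D i)]].
Proof.
apply/seteqP; split => [_ [M [[G /generated_byE ->]] + <-]|_ [D DP <-]].
  rewrite hilbert_vec_mspan => /proper_mspan small.
  exists (fun i => [set s : {set 'I_n} | (s, i) \notin upward G]%SET) => // i.
  split=> [|j|s t ts].
  - by rewrite inE small ?cards0.
  - by rewrite inE small ?cards1.
  - by rewrite inE [t \in _]inE; apply: contra; exact: upward_closed.
(* The non-faces: component [i] of [mspan k P] is the exterior face ideal of [D i]. They are upward
   closed because complexes are downward closed. *)
pose P := [set p : {set 'I_n} * 'I_r.+1 | p.1 \notin D p.2]%SET.
have upP : upward P = P.
  apply: upward_id => s t i st; rewrite !inE /=; apply: contra.
  by have [_ _] := DP i; apply.
exists (mspan k P).
  split; first by exists P; rewrite -{2}upP; exact: mspan_upward_generated.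
  apply/proper_mspan => s i; rewrite inE negbK /=; have [D0 D1 _] := DP i.
  case: (posnP #|s|) => [/cards0_eq -> //|s0 s1].
  by have /eqP/cards1P[j ->] : #|s| = 1%N by apply/eqP; rewrite eqn_leq s1.
rewrite hilbert_vec_mspan; congr ffvec; apply/funext => i; apply/setP => s.
by rewrite !inE negbK.
Qed.

End FaceVectors.

(* The r >= 1 generators are indexed by 'I_r.+1, in MathComp style. *)
Theorem theorem39 (R : realType) (k : fieldType) (n r : nat)
    (d : 'I_r.+1 -> nat) (n_gt0 : (0 < n)%N) (d1 : d ord0 = 0%N)
    (d_mono : forall i j : 'I_r.+1, (i <= j)%N -> (d i <= d j)%N) :
  [/\ conv_hull [set hilbert_vec R d M |
                  M in [set M : {vspace free_mod k n r.+1} |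
                         monomial_submodule M /\ proper_submodule M]]
      = minkowski_sum
          (fun i => koz_shift (n + d ord_max) (d i) @` kozlov_simplex R n),
      minkowski_sum
          (fun i => koz_shift (n + d ord_max) (d i) @` kozlov_simplex R n)
      = kozlov_polytope R n d &
      kozlov_polytope R n d
      = conv_hull [set ffvec R d D |
                    D in [set D : 'I_r.+1 -> {set {set 'I_n}} |
                           forall i, simplicial_complex (D i)]]].
Proof.
have kozE : minkowski_sum
    (fun i => koz_shift (n + d ord_max) (d i) @` kozlov_simplex R n) =
  conv_hull [set ffvec R d D | D in [set D : 'I_r.+1 -> {set {set 'I_n}} |
    forall i, simplicial_complex (D i)]].
  rewrite -ffvec_minkowski -conv_hull_minkowski; congr minkowski_sum.
  (* [koz_shift] is right multiplication by a fixed matrix, hence linear. *)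
  by apply/funext => i; exact: (conv_hull_linear (mulmxr _)).
by split; rewrite ?hilbert_vec_ffvec ?kozE.
Qed.
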